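(* Let $\mathcal{H}$ be a complex separable Hilbert space, $A\in\mathcal{B}(\mathcal{H})$ and $\mathcal{G}\subset\mathcal{H}$ countable such that $\{e^{tA}g\}_{g\in\mathcal{G},\,t\in[0,\infty)}$ is a semi-continuous frame for $\mathcal{H}$. If $\{e^{tA}\}_{t\ge0}$ is exponentially stable, then there exists $0<L<\infty$ such that $\{e^{tA}g\}_{g\in\mathcal{G},\,t\in[0,L]}$ is a semi-continuous frame for $\mathcal{H}$.
   Context: For $A\in\mathcal{B}(\mathcal{H})$, $e^{tA}:=\sum_{n\ge0}\frac{t^n}{n!}A^n$. The semigroup $\{e^{tA}\}_{t\ge0}$ is exponentially stable if there are constants $M\ge1$ and $\omega<0$ with $\|e^{tA}\|\le Me^{\omega t}$ for all $t\ge0$. For a countable $\mathcal{G}\subset\mathcal{H}$ and an interval $\mathcal{T}\subset[0,\infty)$, $\{e^{tA}g\}_{g\in\mathcal{G},t\in\mathcal{T}}$ is a semi-continuous frame for $\mathcal{H}$ if there are constants $c,C>0$ such that $c\|f\|^2\le\sum_{g\in\mathcal{G}}\int_{\mathcal{T}}|\langle f,e^{tA}g\rangle|^2\,dt\le C\|f\|^2$ for all $f\in\mathcal{H}$. *)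

(* Defs.v *)
From HB Require Import structures.
From mathcomp Require Import all_boot all_order all_algebra.
From mathcomp Require Import complex.
From mathcomp Require Import all_classical all_reals all_analysis.
Set Implicit Arguments. Unset Strict Implicit. Unset Printing Implicit Defensive.
Import Order.TTheory GRing.Theory Num.Theory.
Import numFieldNormedType.Exports.
Local Open Scope classical_set_scope.
Local Open Scope ring_scope.

Section Hilbert.
Variables (R : realType) (V : lmodType R[i]) (ip : V -> V -> R[i]).

Definition hnorm (x : V) : R := Num.sqrt (complex.Re (ip x x)).

Definition hcvg (u : nat -> V) (v : V) : Prop :=
  (fun n => hnorm (u n - v)) @ \oo --> (0 : R).

Definition hcauchy (u : nat -> V) : Prop :=
  forall e : R, 0 < e -> exists N : nat,
    forall m n : nat, (N <= m)%N -> (N <= n)%N -> hnorm (u m - u n) < e.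

Definition is_inner_product : Prop :=
  [/\ (forall (a : R[i]) (x y z : V), ip (a *: x + y) z = a * ip x z + ip y z),
      (forall x y : V, ip y x = conjc (ip x y)),
      (forall x : V, 0 <= complex.Re (ip x x)) &
      (forall x : V, ip x x = 0 -> x = 0)].

Definition complex_separable_hilbert : Prop :=
  [/\ is_inner_product,
      (forall u : nat -> V, hcauchy u -> exists v, hcvg u v) &
      (exists D : set V, countable D /\
         forall (x : V) (e : R), 0 < e -> exists d, D d /\ hnorm (x - d) < e)].

Definition bounded_operator (A : V -> V) : Prop :=
  (forall (a : R[i]) (x y : V), A (a *: x + y) = a *: A x + A y) /\
  (exists M : R, forall x : V, hnorm (A x) <= M * hnorm x).

Definition exp_partial (A : V -> V) (t : R) (f : V) (n : nat) : V :=
  \sum_(k < n) ((t ^+ k / (k`!)%:R : R)%:C%C *: iter k A f).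

Definition expA (A : V -> V) (t : R) (f : V) : V :=
  xget 0 [set v | hcvg (exp_partial A t f) v].

Definition cabs2 (z : R[i]) : R := (complex.Re z) ^+ 2 + (complex.Im z) ^+ 2.

Definition exp_stable (A : V -> V) : Prop :=
  exists (M omega : R), 1 <= M /\ omega < 0 /\
    forall t : R, 0 <= t -> forall f : V,
      hnorm (expA A t f) <= M * expR (omega * t) * hnorm f.

Definition frame_sum (A : V -> V) (G : set V) (T : set R) (f : V) : \bar R :=
  \esum_(g in G) (\int[@lebesgue_measure R]_(t in T)
                    (cabs2 (ip f (expA A t g)))%:E)%E.

Definition semi_continuous_frame (A : V -> V) (G : set V) (T : set R) : Prop :=
  exists (c C : R), 0 < c /\ 0 < C /\
    forall f : V,
      ((c * hnorm f ^+ 2)%:E <= frame_sum A G T f)%E /\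
      (frame_sum A G T f <= (C * hnorm f ^+ 2)%:E)%E.

End Hilbert.

(* Main.v *)
Require Import Defs.
From HB Require Import structures.
From mathcomp Require Import all_boot all_order all_algebra.
From mathcomp Require Import complex.
From mathcomp Require Import all_classical all_reals all_analysis.
From mathcomp Require Import measurable_realfun.
From mathcomp Require Import ring lra.
Import Order.TTheory GRing.Theory Num.Theory.
Import numFieldNormedType.Exports.
Local Open Scope classical_set_scope.
Local Open Scope ring_scope.

(** For [L >= 0] the semigroup law gives [e^{(L+s)A} = e^{LA} e^{sA}], so the part of
    the frame sum of [f] over [t >= L] equals the full frame sum of
    [h = (e^{LA})^* f], which is at most [C |h|^2 <= C M^2 e^{2 omega L} |f|^2].
    For [L] large this is at most half of the lower frame bound [c |f|^2], so the
    part over [0 <= t <= L] keeps at least [c/2 |f|^2].  The adjoint vector [h] comes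
    from the Riesz representation theorem. *)

Set Implicit Arguments.
Unset Strict Implicit.

(** * Real-number preliminaries *)

Lemma discriminant_le {R : realFieldType} (a b c : R) : 0 <= a ->
  (forall t, 0 <= a * t ^+ 2 + 2 * b * t + c) -> b ^+ 2 <= a * c.
Proof.
rewrite le_eqVlt => /predU1P[<- h|a0 h]; last first.
  (* The minimum of the quadratic, at its vertex. *)
  have := h (- b / a).
  have -> : a * (- b / a) ^+ 2 + 2 * b * (- b / a) + c = (a * c - b ^+ 2) / a.
    by field; rewrite gt_eqF.
  by rewrite pmulr_lge0 ?invr_gt0// subr_ge0.
rewrite mul0r; have [->|b0] := eqVneq b 0; first by rewrite expr0n.
(* With [a = 0] and [b != 0] the affine function would take the value -1 here. *)
have := h (- (c + 1) / (2 * b)).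
have -> : 0 * (- (c + 1) / (2 * b)) ^+ 2 + 2 * b * (- (c + 1) / (2 * b)) + c = -1.
  by field.
lra.
Qed.

Lemma cvg_dist_bound {R : realType} (u : nat -> R) (l : R) (e : nat -> R) :
  e @ \oo --> 0 -> (forall n, `|u n - l| <= e n) -> u @ \oo --> l.
Proof.
move=> e0 ue.
have el : (fun n => l - e n) @ \oo --> l.
  by rewrite -[X in _ --> X]subr0; apply: cvgB e0; exact: cvg_cst.
have er : (fun n => l + e n) @ \oo --> l.
  by rewrite -[X in _ --> X]addr0; apply: cvgD e0; exact: cvg_cst.
apply: (squeeze_cvgr _ el er); near=> n.
by rewrite -ler_distl.
Unshelve. all: by end_near. Qed.

(** * The real inner product, its norm, and Riesz representation *)

Section InnerProduct.
Context (R : realType) (V : lmodType R[i]) (ip : V -> V -> R[i]).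
Context (Hip : is_inner_product ip).
Local Notation N := (hnorm ip).
Implicit Types (x y z : V) (a c : R[i]) (r : R).

Definition rip x y : R := complex.Re (ip x y).

Lemma ipDl x y z : ip (x + y) z = ip x z + ip y z.
Proof. by have [h _ _ _] := Hip; have := h 1 x y z; rewrite scale1r mul1r. Qed.

Lemma ip0l z : ip 0 z = 0.
Proof. by have := ipDl 0 0 z; rewrite addr0 => /(canLR (addrK _)); rewrite subrr. Qed.

Lemma ipZl a x z : ip (a *: x) z = a * ip x z.
Proof. by have [h _ _ _] := Hip; have := h a x 0 z; rewrite addr0 ip0l addr0. Qed.

Lemma ipC x y : ip y x = conjc (ip x y).
Proof. by have [_ h _ _] := Hip. Qed.

Lemma ripC x y : rip x y = rip y x.
Proof. by rewrite /rip (ipC x y); case: (ip x y). Qed.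

Lemma ripDl x y z : rip (x + y) z = rip x z + rip y z.
Proof. by rewrite /rip ipDl; case: (ip x z); case: (ip y z). Qed.

Lemma ripZl r x z : rip (r%:C%C *: x) z = r * rip x z.
Proof. by rewrite /rip ipZl; case: (ip x z) => u v /=; ring. Qed.

Lemma ripDr x y z : rip z (x + y) = rip z x + rip z y.
Proof. by rewrite ripC ripDl !(ripC z). Qed.

Lemma ripZr r x z : rip z (r%:C%C *: x) = r * rip z x.
Proof. by rewrite ripC ripZl ripC. Qed.

Lemma ripNl x z : rip (- x) z = - rip x z.
Proof. by rewrite /rip -scaleN1r ipZl mulN1r; case: (ip x z). Qed.

Lemma ripNr x z : rip z (- x) = - rip z x.
Proof. by rewrite ripC ripNl ripC. Qed.

(** Conjugate linearity in the second argument makes [ip x ('i *: y)] equal to [- 'i * ip x y]. An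
    identity of real parts valid for all [y] thus extends to [ip]. *)
Lemma Im_ip x y : complex.Im (ip x y) = rip x ('i%C *: y).
Proof.
by rewrite /rip (ipC (_ *: y) x) ipZl (ipC x y); case: (ip x y) => u v /=; ring.
Qed.

Lemma rip_ge0 x : 0 <= rip x x.
Proof. by have [_ _ h _] := Hip; exact: h. Qed.

Lemma hnorm_ge0 x : 0 <= N x.
Proof. exact: sqrtr_ge0. Qed.

Lemma hnorm_sqr x : N x ^+ 2 = rip x x.
Proof. by rewrite sqr_sqrtr// rip_ge0. Qed.

Lemma hnorm_eq0 x : N x = 0 -> x = 0.
Proof.
move=> h; have [_ _ _] := Hip; apply.
have : rip x x = 0 by rewrite -hnorm_sqr h expr0n.
(* Hermitian symmetry makes [ip x x] real, so definiteness applies. *)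
have := ipC x x; rewrite /rip; case: (ip x x) => u v /= [/eqP].
by rewrite -addr_eq0 -mulr2n mulrn_eq0/= => /eqP -> ->.
Qed.

Lemma hnormZ a x : N (a *: x) = Num.sqrt (cabs2 a) * N x.
Proof.
rewrite /hnorm -sqrtrM ?addr_ge0 ?sqr_ge0//; congr Num.sqrt.
rewrite ipZl (ipC (a *: x) x) ipZl; have := ipC x x.
rewrite /cabs2; case: a => u v; case: (ip x x) => p q [/eqP].
by rewrite -addr_eq0 -mulr2n mulrn_eq0/= => /eqP ->; ring.
Qed.

Lemma hnormZr r x : N (r%:C%C *: x) = `|r| * N x.
Proof. by rewrite hnormZ /cabs2/= expr0n/= addr0 sqrtr_sqr. Qed.

Lemma hnorm0 : N 0 = 0.
Proof. by rewrite -(scale0r 0) (_ : 0 = 0%:C%C)// hnormZr normr0 mul0r. Qed.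

Lemma hnormN x : N (- x) = N x.
Proof. by rewrite /hnorm -!/(rip _ _) ripNl ripNr opprK. Qed.

Lemma hdistC x y : N (x - y) = N (y - x).
Proof. by rewrite -hnormN opprB. Qed.

(** The squared norm of [t x + y] is a nonnegative quadratic in the real [t]; its discriminant gives
    the bound. *)
Lemma cauchy_schwarz x y : `|rip x y| <= N x * N y.
Proof.
rewrite -(@ler_pXn2r _ 2)// ?nnegrE ?mulr_ge0 ?hnorm_ge0//.
rewrite real_normK ?num_real// exprMn !hnorm_sqr.
apply: discriminant_le => [|t]; first exact: rip_ge0.
have := rip_ge0 (t%:C%C *: x + y).
by rewrite ripDl !ripDr !ripZl !ripZr (ripC y x); congr (_ <= _); ring.
Qed.

Lemma ler_hnormD x y : N (x + y) <= N x + N y.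
Proof.
rewrite -(@ler_pXn2r _ 2)// ?nnegrE ?addr_ge0 ?hnorm_ge0//.
rewrite sqrrD !hnorm_sqr ripDl !ripDr (ripC y x).
have := le_trans (ler_norm _) (cauchy_schwarz x y); lra.
Qed.

Lemma ler_hdistD z x y : N (x - y) <= N (x - z) + N (z - y).
Proof. rewrite (_ : x - y = x - z + (z - y)); first exact: ler_hnormD.
by rewrite addrA subrK. Qed.

Lemma ler_hnorm_sum n (F : 'I_n -> V) : N (\sum_i F i) <= \sum_i N (F i).
Proof.
apply: (big_ind2 (fun x r => N x <= r)) => [|x u y v hx hy|//]; first by rewrite hnorm0.
exact: (le_trans (ler_hnormD x y) (lerD hx hy)).
Qed.

Lemma parallelogram x y :
  N (x + y) ^+ 2 + N (x - y) ^+ 2 = 2 * N x ^+ 2 + 2 * N y ^+ 2.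
Proof. by rewrite !hnorm_sqr !ripDl !ripDr !ripNl !ripNr; ring. Qed.

Lemma hcvg_bound (u : nat -> V) v (e : nat -> R) :
  e @ \oo --> 0 -> (forall n, N (u n - v) <= e n) -> hcvg ip u v.
Proof.
move=> e0 ue; apply: (squeeze_cvgr _ (cvg_cst 0) e0).
by near=> n; rewrite hnorm_ge0 ue.
Unshelve. all: by end_near. Qed.

Lemma hcvg_unique (u : nat -> V) x y : hcvg ip u x -> hcvg ip u y -> x = y.
Proof.
move=> ux uy; apply/eqP; rewrite -subr_eq0; apply/eqP/hnorm_eq0.
apply/eqP; rewrite eq_le hnorm_ge0 andbT.
have h : (fun n => N (u n - x) + N (u n - y)) @ \oo --> (0 + 0 : R) by exact: cvgD.
rewrite addr0 in h; rewrite -(cvg_lim _ h)//.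
apply: limr_ge; first by apply/cvg_ex; exists 0.
by near=> n; rewrite (le_trans (ler_hdistD (u n) _ _))// hdistC.
Unshelve. all: by end_near. Qed.

Lemma hcvg_lin a (u v : nat -> V) x y : hcvg ip u x -> hcvg ip v y ->
  hcvg ip (fun n => a *: u n + v n) (a *: x + y).
Proof.
move=> ux vy.
have h : (fun n => Num.sqrt (cabs2 a) * N (u n - x) + N (v n - y)) @ \oo
    --> (Num.sqrt (cabs2 a) * 0 + 0 : R).
  by apply: cvgD vy; apply: cvgM ux; exact: cvg_cst.
rewrite mulr0 addr0 in h; apply: (hcvg_bound h) => n.
by rewrite -hnormZ opprD addrACA -scalerBr ler_hnormD.
Qed.

Lemma cvg_rip x (u : nat -> V) v : hcvg ip u v ->
  (fun n => rip (u n) x) @ \oo --> rip v x.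
Proof.
move=> uv; apply: (@cvg_dist_bound _ _ _ (fun n => N (u n - v) * N x)).
  by rewrite -(mul0r (N x)); apply: cvgM uv _; exact: cvg_cst.
by move=> n; rewrite -ripNl -ripDl cauchy_schwarz.
Qed.

(** Variational proof: if [h] represents [phi], then [J x = |x - h|^2 - |h|^2], so [h] is sought as
    the limit of a minimizing sequence of [J]. *)
Lemma riesz_representation (phi : V -> R) (K : R) :
  (forall u : nat -> V, hcauchy ip u -> exists v, hcvg ip u v) ->
  (forall x y, phi (x + y) = phi x + phi y) ->
  (forall r x, phi (r%:C%C *: x) = r * phi x) ->
  (forall x, `|phi x| <= K * N x) ->
  exists h, forall x, rip h x = phi x.
Proof.
move=> complete phiD phiZ phiK.
pose J x := N x ^+ 2 - 2 * phi x.
(* From the bound on [phi], [J x >= |x|^2 - 2 K |x| = (|x| - K)^2 - K^2]. *)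
have J_ge x : - K ^+ 2 <= J x.
  have := sqr_ge0 (N x - K); have := le_trans (ler_norm _) (phiK x).
  by rewrite /J; nra.
have infJ : has_inf (range J).
  by split; [exists (J 0), 0 | exists (- K ^+ 2) => _ [x _ <-]].
set m := inf (range J).
have m_le x : m <= J x by apply: (ge_inf infJ.2); exists x.
have /choice[x Jx] : forall n : nat, exists y, J y < m + n.+1%:R^-1.
  move=> n; by have [|_ [y _ <-]] := @inf_adherent _ _ n.+1%:R^-1 _ infJ; [|exists y].
(* Parallelogram law, with [m] bounding [J] at the midpoint of [y] and [z]; minimizing sequences are
   therefore Cauchy. *)
have J_dist y z : N (y - z) ^+ 2 <= 2 * (J y - m) + 2 * (J z - m).
  have := m_le ((2^-1)%:C%C *: (y + z)); have := parallelogram y z.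
  by rewrite /J phiZ phiD hnormZr exprMn real_normK ?num_real//; lra.
have [h xh] : exists h, hcvg ip x h.
  apply: complete => e e0.
  have [k ke] : exists k : nat, k.+1%:R^-1 < e ^+ 2 / 4.
    have e4 : 0 < e ^+ 2 / 4 by rewrite divr_gt0// exprn_gt0.
    have [k _ /(_ k (leqnn _)) ke] := near_infty_natSinv_lt (PosNum e4).
    by exists k; exact: ke.
  have inv_le (i : nat) : (k <= i)%N -> i.+1%:R^-1 <= k.+1%:R^-1 :> R.
    by move=> ki; rewrite lef_pV2 ?posrE// ler_nat.
  exists k => i j /inv_le ki /inv_le kj.
  have sqr_lt : N (x i - x j) ^+ 2 < e ^+ 2.
    have aux (a b c d p q l : R) : a <= c -> b <= c -> c < e ^+ 2 / 4 ->
        p < l + a -> q < l + b -> d <= 2 * (p - l) + 2 * (q - l) -> d < e ^+ 2.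
      by lra.
    exact: aux ki kj ke (Jx i) (Jx j) (J_dist _ _).
  by rewrite -(@ltr_pXn2r _ 2)// ?nnegrE ?hnorm_ge0 ?ltW.
exists h => v; apply/eqP; rewrite -subr_eq0 -sqrf_eq0 eq_le sqr_ge0 andbT.
(* Since [x n] minimizes [J] up to [1/(n+1)], moving along [v] lowers [J] by at most that much. The
   resulting nonnegative quadratic in [t] has a discriminant that bounds the error at [v]. *)
have sqr_le n : (rip (x n) v - phi v) ^+ 2 <= rip v v * n.+1%:R^-1.
  apply: discriminant_le => [|t]; first exact: rip_ge0.
  have -> : rip v v * t ^+ 2 + 2 * (rip (x n) v - phi v) * t + n.+1%:R^-1 =
      J (x n + t%:C%C *: v) - (J (x n) - n.+1%:R^-1).
    rewrite /J phiD phiZ !hnorm_sqr ripDl !ripDr !ripZl !ripZr (ripC v (x n)).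
    by ring.
  by rewrite subr_ge0 (le_trans _ (m_le _))// lerBlDr ltW.
have cvgl : (fun n => (rip (x n) v - phi v) ^+ 2) @ \oo --> (rip h v - phi v) ^+ 2.
  by apply: cvgM; (apply: cvgB; [exact: cvg_rip|exact: cvg_cst]).
have cvgr : (fun n : nat => rip v v * n.+1%:R^-1) @ \oo --> (0 : R).
  rewrite -(mulr0 (rip v v)); apply: cvgM; first exact: cvg_cst.
  exact: cvg_harmonic.
by apply: (ler_cvg_to cvgl cvgr); exact: nearW.
Qed.

End InnerProduct.

(** * Real polynomials in the bounded operator [A] *)

Section OperatorPolynomial.
Context (R : realType) (V : lmodType R[i]) (ip : V -> V -> R[i]).
Context (Hip : is_inner_product ip) (A : V -> V) (M : R).
Context (Alin : forall (a : R[i]) x y, A (a *: x + y) = a *: A x + A y).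
Context (M0 : 0 <= M) (AM : forall x, hnorm ip (A x) <= M * hnorm ip x).
Local Notation N := (hnorm ip).
Implicit Types (f x y : V) (a : R[i]) (r s t : R) (p q : {poly R}) (n k : nat).

(** Truncated exponential series are handled as polynomials evaluated at [A], so that composing them
    becomes multiplication in [{poly R}]. *)
Definition op_poly p f : V := \sum_(k < size p) (p`_k)%:C%C *: iter k A f.

Lemma op0 : A 0 = 0.
Proof.
have := Alin 1 0 0; rewrite !scale1r addr0 => /(canLR (addrK _)).
by rewrite subrr.
Qed.

Lemma opD x y : A (x + y) = A x + A y.
Proof. by have := Alin 1 x y; rewrite !scale1r. Qed.

Lemma opZ a x : A (a *: x) = a *: A x.
Proof. by have := Alin a x 0; rewrite op0 !addr0. Qed.

Lemma iter_lin k a x y : iter k A (a *: x + y) = a *: iter k A x + iter k A y.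
Proof. by elim: k => //= k ->; rewrite Alin. Qed.

Lemma op_poly_lin p a x y :
  op_poly p (a *: x + y) = a *: op_poly p x + op_poly p y.
Proof.
rewrite /op_poly scaler_sumr -big_split/=; apply: eq_bigr => k _.
by rewrite iter_lin scalerDr !scalerA mulrC.
Qed.

Lemma op_polyB p x y : op_poly p (x - y) = op_poly p x - op_poly p y.
Proof. by rewrite addrC -scaleN1r op_poly_lin scaleN1r addrC. Qed.

(** Padding with zero coefficients lets polynomials of different sizes share one summation range. *)
Lemma op_polyE n p f : (size p <= n)%N ->
  op_poly p f = \sum_(k < n) (p`_k)%:C%C *: iter k A f.
Proof.
move=> pn; rewrite /op_poly.
rewrite (big_ord_widen n (fun k => (p`_k)%:C%C *: iter k A f))// big_mkcond/=.
apply: eq_bigr => k _; case: ltnP => // pk.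
by rewrite nth_default// (_ : 0%:C%C = 0)// scale0r.
Qed.

Lemma op_polyDl p q f : op_poly (p + q) f = op_poly p f + op_poly q f.
Proof.
rewrite !(@op_polyE (maxn (size p) (size q))) ?leq_maxl ?leq_maxr ?size_polyD//.
rewrite -big_split/=; apply: eq_bigr => k _.
by rewrite coefD raddfD scalerDl.
Qed.

Lemma op_polyZl r p f : op_poly (r *: p) f = r%:C%C *: op_poly p f.
Proof.
rewrite !(@op_polyE (size p)) ?size_scale_leq// scaler_sumr.
by apply: eq_bigr => k _; rewrite coefZ rmorphM scalerA.
Qed.

Lemma op_polyBl p q f : op_poly (p - q) f = op_poly p f - op_poly q f.
Proof.
by rewrite op_polyDl -(scaleN1r q) op_polyZl rmorphN1 scaleN1r.
Qed.

Lemma op_polyMX p f : op_poly (p * 'X) f = A (op_poly p f).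
Proof.
rewrite (@op_polyE (size p).+1); last first.
  by rewrite (leq_trans (size_polyMleq _ _))// size_polyX addn2.
rewrite big_ord_recl coefMX eqxx (_ : 0%:C%C = 0)// scale0r add0r.
rewrite (big_morph A opD op0); apply: eq_bigr => k _.
by rewrite coefMX/= opZ.
Qed.

Lemma op_polyM p q f : op_poly (p * q) f = op_poly p (op_poly q f).
Proof.
elim/poly_ind: p => [|p c IH].
  by rewrite mul0r /op_poly size_poly0 !big_ord0.
rewrite mulrDl mulrAC !op_polyDl !op_polyMX IH mul_polyC op_polyZl; congr (_ + _).
rewrite (@op_polyE 1 c%:P); first by rewrite big_ord1 coefC.
by rewrite size_polyC; case: (c == 0).
Qed.

Lemma hnorm_iter k f : N (iter k A f) <= M ^+ k * N f.
Proof.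
elim: k => [|k IH]; first by rewrite mul1r.
by rewrite (le_trans (AM _))// exprS -mulrA ler_wpM2l.
Qed.

(** Scalar majorant: with nonnegative coefficients the triangle inequality reproduces the same
    polynomial at [M]. Estimates on the real exponential are transferred to [A] in this way. *)
Lemma hnorm_op_poly p f : (forall k, 0 <= p`_k) ->
  N (op_poly p f) <= p.[M] * N f.
Proof.
move=> p0; rewrite horner_coef mulr_suml (le_trans (ler_hnorm_sum _ _))//.
apply: ler_sum => k _; rewrite hnormZr// ger0_norm// -mulrA.
by rewrite ler_wpM2l// hnorm_iter.
Qed.

End OperatorPolynomial.

(** * Truncations of the real exponential series *)

Section ExpPoly.
Context {R : realType}.
Implicit Types (s t r : R) (n k : nat).

Definition exp_poly t n : {poly R} := \poly_(k < n) (t ^+ k / k`!%:R).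

Lemma exp_poly_coef_ge0 t n k : 0 <= t -> 0 <= (exp_poly t n)`_k.
Proof.
by move=> t0; rewrite coef_poly; case: ifP => // _; rewrite divr_ge0// exprn_ge0.
Qed.

(** The difference is a block of terms of the series, so [hnorm_op_poly] applies to it. *)
Lemma exp_poly_mono t m n k : 0 <= t -> (m <= n)%N ->
  0 <= (exp_poly t n - exp_poly t m)`_k.
Proof.
move=> t0 mn; rewrite coefB [(exp_poly t m)`_k]coef_poly; case: ltnP => km.
  by rewrite coef_poly (leq_trans km mn) subrr.
by rewrite subr0 exp_poly_coef_ge0.
Qed.

Lemma horner_exp_poly t n r : (exp_poly t n).[r] = series (exp_coeff (t * r)) n.
Proof.
rewrite horner_poly /series/= big_mkord; apply: eq_bigr => k _.
by rewrite /exp_coeff/= exprMn mulrAC.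
Qed.

Lemma cvg_horner_exp_poly t r :
  (fun n => (exp_poly t n).[r]) @ \oo --> expR (t * r).
Proof.
under eq_fun do rewrite horner_exp_poly.
exact: is_cvg_series_exp_coeff.
Qed.

(* In degree < n both sides have the coefficient (s + t)^k / k!, by the binomial
   formula; in higher degree the subtracted polynomial vanishes. *)
Lemma exp_polyD_coef_ge0 s t n k : 0 <= s -> 0 <= t ->
  0 <= (exp_poly s n * exp_poly t n - exp_poly (s + t) n)`_k.
Proof.
move=> s0 t0; rewrite coefB [X in _ - X]coef_poly; case: ltnP => kn; last first.
  rewrite subr0 coefM sumr_ge0// => i _.
  by rewrite mulr_ge0// exp_poly_coef_ge0.
rewrite subr_ge0 le_eqVlt; apply/orP; left; apply/eqP.
rewrite coefM addrC exprDn mulr_suml; apply: eq_bigr => i _.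
have ik : (i <= k)%N by rewrite -ltnS.
rewrite !coef_poly (leq_ltn_trans ik kn) (leq_ltn_trans (leq_subr _ _) kn).
rewrite -mulr_natr -(bin_fact ik) !natrM.
have f0 j : (j`!%:R : R) != 0 by rewrite pnatr_eq0 -lt0n fact_gt0.
have b0 : ('C(k, i)%:R : R) != 0 by rewrite pnatr_eq0 -lt0n bin_gt0.
by field; rewrite !f0 b0.
Qed.

End ExpPoly.

(** * Convergence, semigroup law and adjoint of the exponential *)

Section Exponential.
Context (R : realType) (V : lmodType R[i]) (ip : V -> V -> R[i]).
Context (HV : complex_separable_hilbert ip) (A : V -> V) (HA : bounded_operator ip A).
Local Notation N := (hnorm ip).
Implicit Types (f g x y : V) (a : R[i]) (s t : R) (n k : nat).

Let Hip : is_inner_product ip. Proof. by case: HV. Qed.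
Let Alin a x y : A (a *: x + y) = a *: A x + A y. Proof. by case: HA. Qed.

Lemma bounded_operator_ge0 : exists2 M : R, 0 <= M & forall x, N (A x) <= M * N x.
Proof.
have [_ [M AM]] := HA; exists `|M| => // x.
by rewrite (le_trans (AM x))// ler_wpM2r ?hnorm_ge0// ler_norm.
Qed.

Lemma exp_partialE t f n : exp_partial A t f n = op_poly A (exp_poly t n) f.
Proof.
rewrite (op_polyE _ _ (size_poly _ _)); apply: eq_bigr => k _.
by rewrite coef_poly ltn_ord.
Qed.

(** Comparison with the real series of [e^{tM}] makes the partial sums Cauchy; by completeness
    [xget] then returns a genuine limit and not its default value. *)
Lemma hcvg_expA t f : 0 <= t -> hcvg ip (exp_partial A t f) (expA ip A t f).
Proof.
move=> t0; have [M M0 AM] := bounded_operator_ge0.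
have [_ complete _] := HV.
suff ex : (exists v, hcvg ip (exp_partial A t f) v) by exact: (xgetPex 0 ex).
apply: complete.
have dist m n : (m <= n)%N -> N (exp_partial A t f n - exp_partial A t f m) <=
    `|(exp_poly t n).[M] - (exp_poly t m).[M]| * N f.
  move=> mn; rewrite !exp_partialE -op_polyBl -hornerN -hornerD.
  apply: le_trans (hnorm_op_poly _ M0 AM _ _) _ => //.
    by move=> k; exact: exp_poly_mono.
  by rewrite ler_wpM2r ?hnorm_ge0// ler_norm.
(* Both truncations lie within [d] of the scalar limit; the [+ 1] keeps the denominator positive
   when [f = 0]. *)
move=> e e0; pose d := e / (2 * (N f + 1)).
have Nf1 : 0 < N f + 1 by rewrite ltr_wpDl ?hnorm_ge0.
have d0 : 0 < d by rewrite divr_gt0// mulr_gt0.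
have /cvgrPdist_lt/(_ _ d0)[k _ kd] := @cvg_horner_exp_poly _ t M.
exists k; suff wlog_dist m n : (k <= m)%N -> (m <= n)%N ->
    N (exp_partial A t f n - exp_partial A t f m) < e.
  move=> m n km kn; have [mn|/ltnW nm] := leqP m n; last exact: wlog_dist.
  by rewrite hdistC//; exact: wlog_dist.
move=> km mn; apply: le_lt_trans (dist _ _ mn) _.
have -> : e = (d + d) * (N f + 1) by rewrite /d; field; rewrite gt_eqF.
apply: (@le_lt_trans _ _ ((d + d) * N f)); last first.
  by rewrite ltr_pM2l ?addr_gt0// ltrDl.
rewrite ler_wpM2r ?hnorm_ge0// ltW//.
rewrite (le_lt_trans (ler_distD (expR (t * M)) _ _))// ltrD//; last exact: kd.
by rewrite distrC; apply: kd; exact: leq_trans mn.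
Qed.

Lemma expA_lin t a x y : 0 <= t ->
  expA ip A t (a *: x + y) = a *: expA ip A t x + expA ip A t y.
Proof.
move=> t0; apply: (hcvg_unique Hip (hcvg_expA _ t0)).
have := hcvg_lin Hip a (hcvg_expA x t0) (hcvg_expA y t0).
by apply: cvg_trans; apply: near_eq_cvg; near=> n; rewrite !exp_partialE op_poly_lin.
Unshelve. all: by end_near. Qed.

(** The product of the truncations for [s] and [t] exceeds the one for [s + t] by a polynomial with
    nonnegative coefficients. Its value at [M] tends to [e^{sM} e^{tM} - e^{(s+t)M} = 0]. *)
Lemma expA_add s t f : 0 <= s -> 0 <= t ->
  expA ip A (s + t) f = expA ip A s (expA ip A t f).
Proof.
move=> s0 t0; have [M M0 AM] := bounded_operator_ge0.
apply/esym/(hcvg_unique Hip _ (hcvg_expA _ (addr_ge0 s0 t0))).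
pose E r n := (exp_poly r n).[M].
pose y := expA ip A t f; pose z := expA ip A s y.
(* Three errors: passing to the product of truncations, replacing the truncation for [t] by [y], and
   replacing the truncation for [s] at [y] by [z]. *)
pose e n := (E s n * E t n - E (s + t) n) * N f +
  (E s n * N (exp_partial A t f n - y) + N (exp_partial A s y n - z)).
have e0 : e @ \oo --> 0.
  rewrite -[X in _ --> X]addr0; apply: cvgD.
    rewrite -(mul0r (N f)); apply: cvgM; last exact: cvg_cst.
    rewrite -(subrr (expR ((s + t) * M))) {1}mulrDl expRD.
    by apply: cvgB; [apply: cvgM|]; exact: cvg_horner_exp_poly.
  rewrite -[X in _ --> X]addr0; apply: cvgD; last exact: hcvg_expA.
  rewrite -(mulr0 (expR (s * M))); apply: cvgM; last exact: hcvg_expA.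
  exact: cvg_horner_exp_poly.
apply: (hcvg_bound e0) => n; rewrite -/y -/z.
apply: le_trans (ler_hdistD Hip (op_poly A (exp_poly s n * exp_poly t n) f) _ _) _.
apply: lerD.
  rewrite hdistC// exp_partialE -op_polyBl /E -hornerM -hornerN -hornerD.
  apply: hnorm_op_poly => // k; exact: exp_polyD_coef_ge0.
apply: le_trans (ler_hdistD Hip (exp_partial A s y n) _ _) _; apply: lerD => //.
rewrite op_polyM// !exp_partialE -op_polyB//.
apply: hnorm_op_poly => // k; exact: exp_poly_coef_ge0.
Qed.

(** Riesz representation is applied to the real part of [x |-> ip f (expA ip A t x)]; substituting
    ['i *: x] recovers the imaginary part. *)
Lemma expA_adjoint t K f : 0 <= t -> (forall x, N (expA ip A t x) <= K * N x) ->
  exists2 h, N h <= K * N f & forall x, ip h x = ip f (expA ip A t x).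
Proof.
move=> t0 eK; have [_ complete _] := HV.
pose phi x := rip ip f (expA ip A t x).
have expZ a x : expA ip A t (a *: x) = a *: expA ip A t x.
  have e0 : expA ip A t 0 = 0.
    have := expA_lin 1 0 0 t0; rewrite !scale1r addr0 => /(canLR (addrK _)).
    by rewrite subrr.
  by have := expA_lin a x 0 t0; rewrite e0 !addr0.
have [] := @riesz_representation _ _ _ Hip phi (N f * K) complete.
- by move=> x y; rewrite /phi -[x]scale1r expA_lin// !scale1r ripDr.
- by move=> r x; rewrite /phi expZ ripZr.
- move=> x; rewrite (le_trans (cauchy_schwarz Hip _ _))// -mulrA.
  by rewrite ler_wpM2l ?hnorm_ge0.
move=> h hphi; exists h.
  (* Testing at [h] itself gives [|h|^2 <= K |f| |h|]. *)
  have := hphi h; rewrite -hnorm_sqr// /phi => hh.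
  have : N h ^+ 2 <= K * N f * N h.
    rewrite hh (le_trans (ler_norm _))// (le_trans (cauchy_schwarz Hip _ _))//.
    by rewrite mulrC mulrAC ler_wpM2r ?hnorm_ge0.
  have [->|h0] := eqVneq (N h) 0.
    (* Here [0 <= K * N f] comes from the bound [eK] at [f]. *)
    by move=> _; rewrite (le_trans (hnorm_ge0 ip (expA ip A t f))).
  by rewrite ler_pM2r// lt_neqAle eq_sym h0 hnorm_ge0.
move=> x; have := hphi x; have := hphi ('i%C *: x).
rewrite /phi expZ -!Im_ip// /rip.
by case: (ip h x) => u v; case: (ip f _) => u' v' /= -> ->.
Qed.

End Exponential.

(** * Translation of Lebesgue measure and of integrals over half-lines *)

Section Shift.
Context {R : realType}.
Local Notation mu := (@lebesgue_measure R).

Lemma measurable_addr (L : R) :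
  measurable_fun [set: measurableTypeR R]
    (fun t : measurableTypeR R => (L + t : measurableTypeR R)).
Proof. by apply: measurable_funD. Qed.

(** By uniqueness of Lebesgue measure it is enough to check intervals []a, b]], whose preimages are
    translates of the same length. *)
Lemma lebesgue_measure_shift (L : R) (B : set R) : measurable B ->
  pushforward mu (fun t => L + t : measurableTypeR R) B = mu B.
Proof.
move=> mB; apply/esym.
have mL := measurable_addr L.
apply: lebesgue_measure_unique mB => _ [[a b]] _ <-.
have preE : (fun t => L + t) @^-1` `]a, b]%classic = `]a - L, b - L]%classic.
  by apply/seteqP; split => t /=; rewrite !in_itv/= ltrBlDl lerBrDl.
rewrite /= -[RHS]/(mu ((fun t => L + t) @^-1` `]a, b]%classic)) preE.
rewrite !lebesgue_measure_itv/= !lte_fin ltrD2r.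
by case: ifP => // _; rewrite -!EFinB; congr EFin; ring.
Qed.

Lemma ge0_integral_shift (L : R) (f : R -> \bar R) :
  measurable_fun (`[L, +oo[%classic : set R) f -> (forall t, 0 <= f t)%E ->
  (\int[mu]_(t in `[L, +oo[) f t = \int[mu]_(t in `[0%R, +oo[) f (L + t)%R)%E.
Proof.
move=> mf f0.
have mL := measurable_addr L.
rewrite (_ : `[0, +oo[%classic =
    (fun t : measurableTypeR R => L + t : measurableTypeR R) @^-1` `[L, +oo[); last first.
  by apply/seteqP; split => t /=; rewrite !in_itv/= !andbT lerDl.
rewrite -(@ge0_integral_pushforward _ _ _ _ _ _ mL mu)//=.
by apply: eq_measure_integral => //= B mB _; exact/esym/lebesgue_measure_shift.
Qed.

Lemma ge0_integral_split (L : R) (f : R -> \bar R) : 0 <= L ->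
  measurable_fun (`[0, +oo[%classic : set R) f -> (forall t, 0 <= f t)%E ->
  (\int[mu]_(t in `[0%R, +oo[) f t <=
   \int[mu]_(t in `[0%R, L]) f t + \int[mu]_(t in `[0%R, +oo[) f (L + t)%R)%E.
Proof.
move=> L0 mf f0.
(* The tail is open at [L] to be disjoint from [[0, L]]; the endpoint, a null set, is restored
   before shifting. *)
have mfo : measurable_fun (`]L, +oo[%classic : set R) f.
  apply: measurable_funS mf => // t /=; rewrite !in_itv/= !andbT => /ltW.
  exact: le_trans.
have LE : (`[0, +oo[ = `[0, L] `|` `]L, +oo[)%classic.
  apply/seteqP; split => t /=; rewrite !in_itv/= !andbT.
    by move=> ->; case: (leP t L) => _; [left|right].
  by case=> [/andP[]//|/ltW]; exact: le_trans.
rewrite [X in (X <= _)%E](_ : _ =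
  \int[mu]_(t in `[0%R, L] `|` `]L, +oo[) f t)%E; last by rewrite -LE.
rewrite ge0_integral_setU//=; last 2 first.
- by rewrite -LE.
- apply/disj_setPRL => t /=; rewrite !in_itv/= andbT => Lt; apply/negP.
  by rewrite negb_and -!ltNge Lt orbT.
rewrite leeD2l// integral_itv_obnd_cbnd// ge0_integral_shift//.
apply: measurable_funS mf => // t /=; rewrite !in_itv/= !andbT.
exact: le_trans.
Qed.

End Shift.

(** * Measurability of the integrands and splitting of the frame sum *)

Section FrameTail.
Context (R : realType) (V : lmodType R[i]) (ip : V -> V -> R[i]).
Context (HV : complex_separable_hilbert ip) (A : V -> V) (HA : bounded_operator ip A).
Implicit Types (f g h : V) (t L : R).

Let Hip : is_inner_product ip. Proof. by case: HV. Qed.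

(** The second term is the square of the imaginary part of [ip f g], so measurability reduces to
    that of [rip]. *)
Lemma cabs2_ip f g : cabs2 (ip f g) = rip ip f g ^+ 2 + rip ip ('i%C *: f) g ^+ 2.
Proof. by rewrite /cabs2 /rip ipZl//; case: (ip f g) => u v /=; ring. Qed.

(** A pointwise limit of polynomials in [t]; [hcvg_expA] supplies the convergence for [t >= 0]. *)
Lemma measurable_rip_expA f g :
  measurable_fun (`[0, +oo[%classic : set R) (fun t => rip ip f (expA ip A t g)).
Proof.
apply: (@measurable_fun_cvg _ _ _ _ (fun n t =>
  \sum_(k < n) t ^+ k * (k`!%:R^-1 * rip ip f (iter k A g)))).
  move=> n; apply: measurable_sum => k.
  by apply: measurable_funM => //; exact: measurable_funX.
move=> t; rewrite /= in_itv/= andbT => t0.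
under eq_fun => n.
  rewrite (_ : \sum_(_ < _) _ = rip ip (exp_partial A t g n) f); first over.
  rewrite /exp_partial ripC//.
  rewrite (big_morph (rip ip f) (fun x y => ripDr Hip x y f) (id1 := 0)).
    by apply: eq_bigr => k _; rewrite ripZr// mulrA.
  by have := ripDr Hip 0 0 f; rewrite addr0 => /(canLR (addrK _)); rewrite subrr.
by rewrite (ripC Hip f); apply: (cvg_rip Hip); exact: hcvg_expA.
Qed.

Lemma measurable_cabs2_expA f g :
  measurable_fun (`[0, +oo[%classic : set R)
    (fun t => (cabs2 (ip f (expA ip A t g)))%:E).
Proof.
have -> : (fun t => (cabs2 (ip f (expA ip A t g)))%:E) = EFin \o (fun t =>
    rip ip f (expA ip A t g) ^+ 2 + rip ip ('i%C *: f) (expA ip A t g) ^+ 2).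
  by apply/funext => t; rewrite cabs2_ip.
apply/measurable_EFinP/measurable_funD.
  by apply: measurable_funM; exact: measurable_rip_expA.
by apply: measurable_funM; exact: measurable_rip_expA.
Qed.

Lemma cabs2_ge0 (z : R[i]) : 0 <= cabs2 z.
Proof. by rewrite addr_ge0// sqr_ge0. Qed.

(** Monotonicity in the interval carries the upper frame bound over to [[0, L]]. *)
Lemma frame_sum_itvS G f L :
  (frame_sum ip A G [set t | (0 <= t <= L)%R] f <=
   frame_sum ip A G [set t | (0 <= t)%R] f)%E.
Proof.
rewrite -set_itvcc -set_itvcy; apply: le_esum => g _.
apply: ge0_subset_integral => //=.
- exact: measurable_cabs2_expA.
- by move=> t _; rewrite lee_fin cabs2_ge0.
- by move=> t /=; rewrite !in_itv/= andbT => /andP[].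
Qed.

(* The tail over [L, +oo[ is the full frame sum of h = (e^{LA})^* f. *)
Lemma frame_sum_split G f h L : 0 <= L ->
  (forall x, ip h x = ip f (expA ip A L x)) ->
  (frame_sum ip A G [set t | (0 <= t)%R] f <=
   frame_sum ip A G [set t | (0 <= t <= L)%R] f +
   frame_sum ip A G [set t | (0 <= t)%R] h)%E.
Proof.
move=> L0 hE; rewrite -set_itvcc -set_itvcy.
have ge0 T f' g : (0 <= \int[@lebesgue_measure R]_(t in T)
    (cabs2 (ip f' (expA ip A t g)))%:E)%E.
  by apply: integral_ge0 => t _; rewrite lee_fin cabs2_ge0.
rewrite /frame_sum -esumD//; apply: le_esum => g _.
have F0 t : (0 <= (cabs2 (ip f (expA ip A t g)))%:E)%E by rewrite lee_fin cabs2_ge0.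
have split := ge0_integral_split L0 (measurable_cabs2_expA f g) F0.
apply: (le_trans split); apply: leeD2l; rewrite le_eqVlt; apply/orP; left; apply/eqP.
apply: eq_integral => t; rewrite inE/= in_itv/= andbT => t0.
by rewrite hE (expA_add HV HA g L0 t0).
Qed.

End FrameTail.

(** The witness solves [- omega * L = K / c], and [K / c <= e^{K/c}] follows from [1 + x <= e^x]. *)
Lemma expR_decay (R : realType) (omega c K : R) : omega < 0 -> 0 < c -> 0 < K ->
  exists2 L : R, 0 < L & K * expR (omega * L) <= c.
Proof.
move=> omega0 c0 K0; exists (K / (c * - omega)).
  by rewrite divr_gt0// mulr_gt0// oppr_gt0.
have -> : omega * (K / (c * - omega)) = - (K / c).
  by field; rewrite (lt_eqF omega0) (gt_eqF c0).
rewrite expRN ler_pdivrMr ?expR_gt0// mulrC -ler_pdivrMr//.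
by rewrite (le_trans _ (expR_ge1Dx _))// lerDr.
Qed.

(** * Choice of the interval length and of the frame bounds *)

Unset Implicit Arguments.

Theorem mainTheorem3 (R : realType) (V : lmodType R[i]) (ip : V -> V -> R[i])
  (HV : complex_separable_hilbert ip)
  (A : V -> V) (HA : bounded_operator ip A)
  (G : set V) (HG : countable G)
  (Hframe : semi_continuous_frame ip A G [set t : R | 0 <= t])
  (Hstab : exp_stable ip A) :
  exists L : R, 0 < L /\
    semi_continuous_frame ip A G [set t : R | 0 <= t <= L].
Proof.
have [c [C [c0 [C0 frame]]]] := Hframe.
have [M [omega [M1 [omega0 stable]]]] := Hstab.
have M0 : 0 < M by exact: lt_le_trans M1.
(* The stability bound enters through [|h|^2], hence the squared [M] and the doubled exponent. *)
have [L L0 decay] : exists2 L : R, 0 < L &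
    C * M ^+ 2 * expR (2 * omega * L) <= c / 2.
  apply: expR_decay; [by rewrite pmulr_rlt0|by rewrite divr_gt0|].
  by rewrite mulr_gt0// exprn_gt0.
exists L; split => //; exists (c / 2), C; split; first by rewrite divr_gt0.
split=> // f; have [lower upper] := frame f; split; last first.
  exact: le_trans (frame_sum_itvS HV HA _ _ _) upper.
have [h hK hE] := expA_adjoint HV HA f (ltW L0) (stable L (ltW L0)).
have tail : C * hnorm ip h ^+ 2 <= c / 2 * hnorm ip f ^+ 2.
  have hK2 : hnorm ip h ^+ 2 <= M ^+ 2 * expR (2 * omega * L) * hnorm ip f ^+ 2.
    have -> : 2 * omega * L = omega * L + omega * L by ring.
    rewrite expRD -expr2 -!exprMn.
    by rewrite ler_pXn2r ?nnegrE ?mulr_ge0 ?hnorm_ge0 ?expR_ge0 ?(ltW M0).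
  apply: le_trans (ler_wpM2l (ltW C0) hK2) (le_trans _ (ler_wpM2r (sqr_ge0 _) decay)).
  by rewrite le_eqVlt; apply/orP; left; apply/eqP; ring.
have [_ tail_upper] := frame h.
have bound : ((c * hnorm ip f ^+ 2)%:E <=
    frame_sum ip A G [set t | (0 <= t <= L)%R] f + (c / 2 * hnorm ip f ^+ 2)%:E)%E.
  apply: le_trans (le_trans lower (frame_sum_split HV HA G (ltW L0) hE)) _.
  by apply: leeD2l; apply: le_trans tail_upper _; rewrite lee_fin.
(* The tail bound is finite, so it can be subtracted in the extended reals. *)
rewrite (_ : c / 2 * _ = c * hnorm ip f ^+ 2 - c / 2 * hnorm ip f ^+ 2).
  by rewrite EFinB leeBlDr.
by field.
Qed.
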